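(* Let $\mathcal{B}$ be a swap structure for $\mathbf{mbCciw}$. Then there exist a set $I$ and a monomorphism of multialgebras $\hat h:\mathcal{B}\to\prod_{i\in I}\mathcal{B}_{\mathbb{A}_2}^{\mathbf{mbCciw}}$.
   Context: Let $\Sigma=\{\wedge,\vee,\to,\neg,\circ\}$, with $\wedge,\vee,\to$ binary and $\neg,\circ$ unary. A multialgebra over $\Sigma$ is a nonempty set $B$ with, for each $n$-ary symbol $c$, a function $c^{\mathcal{B}}:B^n\to\wp(B)\setminus\{\emptyset\}$. A homomorphism $f:\mathcal{A}\to\mathcal{B}$ is a function between the domains with $f[c^{\mathcal{A}}(\vec a)]\subseteq c^{\mathcal{B}}(f(\vec a))$ for all $c$ and $\vec a$. These form the category $\mathbf{MAlg}(\Sigma)$; a monomorphism of multialgebras is a monomorphism in this category. The product $\prod_{i\in I}\mathcal{A}_i$ has as domain the cartesian product of the domains and multioperations $c(\vec a)=\prod_{i\in I}c^{\mathcal{A}_i}(\pi_i(\vec a))$ (for $I=\emptyset$ it is the one-element multialgebra). For a Boolean algebra $\mathcal{A}$ with domain $A$ (the one-element Boolean algebra is allowed) and $z\in A^3$ write $z=(z_1,z_2,z_3)$; $\sim$ is Boolean complement. Put $\mathrm{B}_{\mathcal{A}}^{\mathbf{ciw}}=\{z\in A^3 : z_1\vee z_2=1 \text{ and } z_3={\sim}(z_1\wedge z_2)\}$. A swap structure for $\mathbf{mbCciw}$ over $\mathcal{A}$ is a multialgebra $\mathcal{B}$ over $\Sigma$ with domain $B\subseteq \mathrm{B}_{\mathcal{A}}^{\mathbf{ciw}}$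 such that $0\in\{z_1: z\in B\}$ and for all $z,w\in B$: (i) $\emptyset\ne z\#w\subseteq\{u\in B: u_1=z_1\# w_1\}$ for $\#\in\{\wedge,\vee,\to\}$; (ii) $\emptyset\neq\neg z\subseteq\{u\in B:u_1=z_2\}$; (iii) $\emptyset\ne\circ z\subseteq\{u\in B:u_1=z_3\}$. A swap structure for $\mathbf{mbCciw}$ is one over some Boolean algebra. The full swap structure $\mathcal{B}_{\mathcal{A}}^{\mathbf{mbCciw}}$ has domain $\mathrm{B}_{\mathcal{A}}^{\mathbf{ciw}}$ and equality in the right-hand inclusions of (i)–(iii). $\mathbb{A}_2$ is the two-element Boolean algebra. *)

(* Defs.v *)
From HB Require Import structures.
From mathcomp Require Import all_boot all_order.
From mathcomp Require Import boolp classical_sets.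

Set Implicit Arguments.
Unset Strict Implicit.
Unset Printing Implicit Defensive.

Import Order.Theory.

Local Open Scope classical_set_scope.

Inductive binary_symbol : Set := And | Or | Imp.
Inductive unary_symbol : Set := Neg | Circ.

Record multioperations (T : Type) := Multioperations {
  bin : binary_symbol -> T -> T -> set T;
  un : unary_symbol -> T -> set T;
  bin_nonempty : forall c x y, bin c x y !=set0;
  un_nonempty : forall c x, un c x !=set0 }.

Record multialgebra := Multialgebra {
  carrier :> Type;
  carrier_nonempty : inhabited carrier;
  ops : multioperations carrier }.

Record hom (X Y : multialgebra) := Hom {
  hom_fun :> X -> Y;
  hom_bin : forall c x y,
    hom_fun @` bin (ops X) c x y `<=` bin (ops Y) c (hom_fun x) (hom_fun y);
  hom_un : forall c x,
    hom_fun @` un (ops X) c x `<=` un (ops Y) c (hom_fun x) }.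

Lemma comp_hom_bin (X Y Z : multialgebra) (f : hom Y Z) (g : hom X Y) c x y :
  (f \o g) @` bin (ops X) c x y `<=` bin (ops Z) c ((f \o g) x) ((f \o g) y).
Proof.
move=> _ [u ux <-]; apply: (@hom_bin _ _ f); exists (g u) => //.
by apply: hom_bin; exists u.
Qed.

Lemma comp_hom_un (X Y Z : multialgebra) (f : hom Y Z) (g : hom X Y) c x :
  (f \o g) @` un (ops X) c x `<=` un (ops Z) c ((f \o g) x).
Proof.
move=> _ [u ux <-]; apply: (@hom_un _ _ f); exists (g u) => //.
by apply: hom_un; exists u.
Qed.

Definition comp_hom (X Y Z : multialgebra) (f : hom Y Z) (g : hom X Y) :
  hom X Z := Hom (@comp_hom_bin X Y Z f g) (@comp_hom_un X Y Z f g).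

(* Left cancellability in the category of multialgebras; this is not defined
   as injectivity of the underlying function. *)
Definition monomorphism (X Y : multialgebra) (f : hom X Y) : Prop :=
  forall (Z : multialgebra) (g1 g2 : hom Z X),
    comp_hom f g1 = comp_hom f g2 -> g1 = g2.

Lemma prod_bin_nonempty (I : Type) (X : I -> multialgebra) c
    (x y : forall i, X i) :
  [set u : forall i, X i | forall i, bin (ops (X i)) c (x i) (y i) (u i)]
    !=set0.
Proof.
exists (fun i => projT1 (cid (bin_nonempty (ops (X i)) c (x i) (y i)))) => i.
by case: cid.
Qed.

Lemma prod_un_nonempty (I : Type) (X : I -> multialgebra) c
    (x : forall i, X i) :
  [set u : forall i, X i | forall i, un (ops (X i)) c (x i) (u i)] !=set0.
Proof.
exists (fun i => projT1 (cid (un_nonempty (ops (X i)) c (x i)))) => i.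
by case: cid.
Qed.

Lemma prod_carrier_nonempty (I : Type) (X : I -> multialgebra) :
  inhabited (forall i, X i).
Proof.
have w i : exists x : X i, True by case: (carrier_nonempty (X i)) => x; exists x.
by constructor=> i; exact: (projT1 (cid (w i))).
Qed.

Definition prod_multialgebra (I : Type) (X : I -> multialgebra) :
  multialgebra :=
  Multialgebra (prod_carrier_nonempty X)
    (Multioperations (@prod_bin_nonempty I X) (@prod_un_nonempty I X)).

Definition triple (T : Type) : Type := T * T * T.
Definition pr1 (T : Type) (z : triple T) : T := z.1.1.
Definition pr2 (T : Type) (z : triple T) : T := z.1.2.
Definition pr3 (T : Type) (z : triple T) : T := z.2.

(* Boolean algebras are ctbDistrLatticeTypes: \bot = \top is not excluded. *)
Definition bool_bin d (A : ctbDistrLatticeType d) (c : binary_symbol) :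
  A -> A -> A :=
  match c with
  | And => fun x y => (x `&` y)%O
  | Or => fun x y => (x `|` y)%O
  | Imp => fun x y => (~` x `|` y)%O
  end.

(* The coordinate of z prescribed as first coordinate of the members of
   the value of a unary multioperation at z. *)
Definition un_coord (T : Type) (c : unary_symbol) : triple T -> T :=
  match c with Neg => @pr2 T | Circ => @pr3 T end.

Definition Bciw d (A : ctbDistrLatticeType d) : set (triple A) :=
  [set z | (pr1 z `|` pr2 z = \top)%O /\ (pr3 z = ~` (pr1 z `&` pr2 z))%O].
Arguments Bciw {d} A _ : assert.

Record swap_structure d (A : ctbDistrLatticeType d) := SwapStructure {
  dom : set (triple A);
  swap_ops : multioperations dom;
  dom_sub : dom `<=` Bciw A;
  dom_bot : [set pr1 z | z in dom] \bot%O;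
  swap_bin : forall c (z w : dom),
    bin swap_ops c z w `<=`
      [set u : dom | pr1 (val u) = bool_bin c (pr1 (val z)) (pr1 (val w))];
  swap_un : forall c (z : dom),
    un swap_ops c z `<=` [set u : dom | pr1 (val u) = un_coord c (val z)] }.

Lemma dom_nonempty d (A : ctbDistrLatticeType d) (B : swap_structure A) :
  inhabited (dom B).
Proof.
by case: (dom_bot B) => z Bz _; constructor; exact: (SigSub (mem_set Bz)).
Qed.

Definition swap_multialgebra d (A : ctbDistrLatticeType d)
  (B : swap_structure A) : multialgebra :=
  Multialgebra (dom_nonempty B) (swap_ops B).
Coercion swap_multialgebra : swap_structure >-> multialgebra.

Lemma Bciw_ex d (A : ctbDistrLatticeType d) (a : A) :
  exists2 z, Bciw A z & pr1 z = a.
Proof.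
exists (a, (~` a)%O, \top%O) => //.
by rewrite /Bciw /pr1 /pr2 /pr3 /=; split; rewrite ?joinxC // meetxC compl0.
Qed.

Lemma Bciw_fiber_nonempty d (A : ctbDistrLatticeType d) (a : A) :
  [set u : Bciw A | pr1 (val u) = a] !=set0.
Proof. by have [z Bz za] := Bciw_ex a; exists (SigSub (mem_set Bz)). Qed.

Definition full_ops d (A : ctbDistrLatticeType d) : multioperations (Bciw A) :=
  Multioperations
    (fun c z w => Bciw_fiber_nonempty
       (bool_bin c (pr1 (val z)) (pr1 (val w))))
    (fun c z => Bciw_fiber_nonempty (un_coord c (val z))).

Definition full_swap_structure d (A : ctbDistrLatticeType d) :
  swap_structure A :=
  @SwapStructure d A (Bciw A) (full_ops A) (fun _ h => h) (Bciw_ex \bot%O)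
    (fun _ _ _ _ h => h) (fun _ _ _ h => h).

(* Main.v *)
(* Stone duality: the ultrafilters of a Boolean algebra A, i.e. its
   homomorphisms to the two-element algebra, separate the points of A. Applying
   each of them to the three coordinates of a snapshot sends a swap structure
   over A into the full one over the two-element algebra, and the resulting
   family of homomorphisms is jointly injective. *)
Require Import Defs.
From mathcomp Require Import all_boot all_order.
From mathcomp Require Import boolp classical_sets.

Set Implicit Arguments.
Unset Strict Implicit.
Unset Printing Implicit Defensive.

Import Order.Theory.
Local Open Scope classical_set_scope.

Lemma hom_eq (X Y : multialgebra) (f g : hom X Y) : f =1 g -> f = g.
Proof.
case: f g => [f fb fu] [g gb gu] /funext /= fg.
by subst g; congr Hom; exact: Prop_irrelevance.
Qed.

Lemma injective_monomorphism (X Y : multialgebra) (f : hom X Y) :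
  injective f -> monomorphism f.
Proof.
move=> f_inj Z g1 g2 /(congr1 (@hom_fun Z Y)) fg.
by apply: hom_eq => z; apply: f_inj; exact: (congr1 (@^~ z) fg).
Qed.

Section BooleanHomomorphisms.
Variables (d : Order.disp_t) (A : ctbDistrLatticeType d).

Definition proper_filter (X : set A) : Prop :=
  [/\ forall x y, (x <= y)%O -> X x -> X y,
      forall x y, X x -> X y -> X (x `&` y)%O & ~ X \bot%O].

(** Zorn's lemma on the proper filters containing [c]: a maximal one decides every [x], since
    otherwise it could be enlarged. *)
Lemma ultrafilter_exists (c : A) : c != \bot%O ->
  exists X : set A,
    [/\ proper_filter X, X c & forall x, X x \/ X (~` x)%O].
Proof.
move=> c0.
(* The empty set is admitted because the union of the empty chain is empty. *)
pose P (X : set A) := X = set0 \/ (proper_filter X /\ X c).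
have [F FP Ftot|X [PX Xmax]] := @Zorn_bigcup A P.
  (* If no member of the chain contains [c], all are empty and so is the union. Otherwise the union
     is a proper filter: totality puts any two of its elements in a common member. *)
  have [[X FX Xc]|noc] := pselect (exists2 X, F X & X c); last first.
    left; rewrite -subset0 => x [X FX Xx].
    have [X0|[_ Xc]] := FP _ FX; first by rewrite X0 in Xx.
    by apply: noc; exists X.
  have FF Y y : F Y -> Y y -> proper_filter Y.
    by move=> /FP[-> //|[]].
  right; split; last by exists X.
  split.
  - move=> x y xy [Y FY Yx]; exists Y => //.
    by have [up _ _] := FF _ _ FY Yx; exact: up Yx.
  - move=> x y [Y FY Yx] [Z FZ Zy].
    have [YZ|ZY] := Ftot _ _ FY FZ.
      by exists Z => //; have [_ I _] := FF _ _ FZ Zy; apply: I => //; apply: YZ.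
    by exists Y => //; have [_ I _] := FF _ _ FY Yx; apply: I => //; apply: ZY.
  - by move=> [Y FY Y0]; have [_ _] := FF _ _ FY Y0.
(* The empty set is not maximal: the principal filter of [c] is larger, and it is proper because [c]
   is nonzero. *)
have [X0|[Xfilter Xc]] := PX.
  case: (Xmax [set x | (c <= x)%O]).
    by rewrite X0; split=> // /(_ c (lexx c)).
  right; split; last exact: lexx.
  split=> /=.
  - by move=> x y xy cx; exact: le_trans xy.
  - by move=> x y cx cy; rewrite lexI cx.
  - by rewrite lex0; apply/negP.
exists X; split=> // x; apply: contrapT => /not_orP[nx nCx].
have [up I X0] := Xfilter.
(* The filter generated by [X] and [x] would be strictly larger. It is proper: a [u] in [X] disjoint
   from [x] lies below the complement of [x], which would then belong to [X]. *)
case: (Xmax [set y | exists2 u, X u & (u `&` x <= y)%O]).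
  split=> [y Xy|subX]; first by exists y => //; exact: leIl.
  by apply: nx; apply: subX; exists c => //; exact: leIr.
right; split; last by exists c => //; exact: leIl.
split=> /=.
- by move=> y z yz [u Xu uy]; exists u => //; exact: le_trans yz.
- move=> y z [u Xu uy] [v Xv vz]; exists (u `&` v)%O; first exact: I.
  rewrite lexI (le_trans _ uy) ?(le_trans _ vz) //.
    by apply: leI2 => //; exact: leIr.
  by apply: leI2 => //; exact: leIl.
- case=> u Xu; rewrite lex0 => /eqP ux; apply: nCx; apply: up Xu.
  by rewrite -disj_leC ux.
Qed.

(** Meets and complements suffice: joins follow by De Morgan, and the top is the join of the bottom
    with its complement. *)
Definition bool_hom (f : A -> bool) : Prop :=
  (forall x y, f (x `&` y)%O = f x && f y) /\ (forall x, f (~` x)%O = ~~ f x).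

Lemma bool_homU f : bool_hom f -> forall x y, f (x `|` y)%O = f x || f y.
Proof.
by move=> [fI fC] x y; rewrite -[LHS]negbK -fC complU fI !fC negb_and !negbK.
Qed.

Lemma bool_hom1 f : bool_hom f -> f \top%O.
Proof. by move=> fh; rewrite -(joinxC \bot%O) bool_homU // fh.2 orbN. Qed.

Lemma bool_hom_bin f : bool_hom f -> forall c x y,
  f (bool_bin c x y) = bool_bin c (f x) (f y).
Proof.
by move=> fh [] x y /=; rewrite ?(bool_homU fh) ?fh.1 ?fh.2 //.
Qed.

(** The meet of [a] with the complement of [b] is nonzero, so an ultrafilter contains it; [f] is the
    indicator function of that ultrafilter. *)
Lemma bool_hom_nle (a b : A) : ~~ (a <= b)%O ->
  exists f, [/\ bool_hom f, f a & ~~ f b].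
Proof.
move=> ab; have c0 : (a `&` ~` b)%O != \bot%O.
  by apply: contraNneq ab => /eqP; rewrite disj_leC complK.
have [X [[up I X0] Xc XC]] := ultrafilter_exists c0.
have notC x : X x -> X (~` x)%O -> False.
  by move=> Xx XCx; apply: X0; rewrite -(meetxC x); exact: I.
exists (fun x => `[< X x >]); split.
- split=> x.
    move=> y; apply/asboolP/andP=> [Xxy|[/asboolP Xx /asboolP Xy]]; last exact: I.
    by split; apply/asboolP; apply: up Xxy; rewrite ?leIl ?leIr.
  apply/asboolP/asboolPn=> [XCx Xx|nXx]; first exact: (notC x).
  by case: (XC x).
- by apply/asboolP; apply: up Xc; exact: leIl.
- apply/asboolPn => Xb; apply: (notC b) => //; apply: up Xc; exact: leIr.
Qed.

Lemma bool_hom_separate (a b : A) :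
  (forall f, bool_hom f -> f a = f b) -> a = b.
Proof.
move=> fab; have le x y : (forall f, bool_hom f -> f x = f y) -> (x <= y)%O.
  by move=> fxy; apply: contraT => /bool_hom_nle[f [/fxy -> ->]].
by apply: le_anti; rewrite !le // => f /fab.
Qed.

Definition map_triple (f : A -> bool) (z : triple A) : triple bool :=
  (f (pr1 z), f (pr2 z), f (pr3 z)).

Lemma map_triple_Bciw f z : bool_hom f -> Bciw A z -> Bciw bool (map_triple f z).
Proof.
move=> fh [z12 z3]; split; rewrite /map_triple /pr1 /pr2 /pr3 /=.
  by rewrite -[LHS](bool_homU fh) z12 bool_hom1.
by rewrite -[z.2]/(pr3 z) z3 fh.2 fh.1.
Qed.

End BooleanHomomorphisms.

Section Representation.
Variables (d : Order.disp_t) (A : ctbDistrLatticeType d) (B : swap_structure A).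

(** Over the one-element algebra [I] is empty and [Y] is a single point, which is harmless since
    [Bciw A] then has only one element. *)
Let I := {f : A -> bool | bool_hom f}.
Let Y := prod_multialgebra (fun _ : I => full_swap_structure bool).

Definition stone_fun (z : B) : Y := fun i =>
  SigSub (mem_set (map_triple_Bciw (svalP i) (dom_sub (set_valP z)))).

(** The target being full, membership in its multioperations constrains only the first coordinate of
    each component, where it is the homomorphism property of the index. *)
Lemma stone_bin c x y :
  stone_fun @` bin (ops B) c x y `<=` bin (ops Y) c (stone_fun x) (stone_fun y).
Proof.
move=> _ [u /swap_bin /= ux <-] i /=.
by rewrite /pr1 /= -bool_hom_bin; [congr (sval i _)|exact: svalP].
Qed.

Lemma stone_un c x :
  stone_fun @` un (ops B) c x `<=` un (ops Y) c (stone_fun x).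
Proof.
move=> _ [u /swap_un /= ux <-] i /=.
by case: c ux => /= ux; rewrite /pr1 /=; congr (sval i _).
Qed.

Definition stone_hom : hom B Y := Hom stone_bin stone_un.

Lemma stone_hom_inj : injective stone_hom.
Proof.
move=> z w zw; apply: val_inj.
(* Equality of the components at index [f] compares all three coordinates, so each can be separated
   on its own. *)
have E f : bool_hom f -> map_triple f (val z) = map_triple f (val w).
  by move=> fh; have /(congr1 val) := congr1 (@^~ (exist _ f fh)) zw.
case: (val z) (val w) E => [[z1 z2] z3] [[w1 w2] w3] E.
by congr (_, _, _); apply: bool_hom_separate => f /E [].
Qed.

End Representation.

Theorem theorem8p20 (d : Order.disp_t) (A : ctbDistrLatticeType d)
    (B : swap_structure A) :
  exists (I : Type)
    (h : hom B (prod_multialgebra (fun _ : I => full_swap_structure bool))),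
    monomorphism h.
Proof.
exists {f : A -> bool | bool_hom f}, (stone_hom B).
exact/injective_monomorphism/stone_hom_inj.
Qed.
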